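(* Let $g\in\mathbb{N}$, let $\boldsymbol{\theta}_0\in\Theta_g^0$, and let $X_1,X_2,\dots$ be IID random variables with polygonal density $f(\cdot;\boldsymbol{\theta}_0)$. For each $n$, let $\boldsymbol{X}_n=\{X_j\}_{j=1}^n$ and let $\hat{\boldsymbol{\theta}}_n\in\Theta_g^n$ be a maximum likelihood estimator, that is, an estimator (measurable function of $\boldsymbol{X}_n$) taking values in the set $\Theta_g^n$ of global maximizers over $\Theta_g$ of the log-likelihood $L(\cdot;\boldsymbol{X}_n)$. Then for every $\epsilon>0$ and every compact set $\mathbb{K}\subset\Theta_g$, $$\lim_{n\to\infty}P\left(\inf_{\boldsymbol{\theta}\in\Theta_g^0}\left\|\hat{\boldsymbol{\theta}}_n-\boldsymbol{\theta}\right\|_2\geq\epsilon\ \text{ and }\ \hat{\boldsymbol{\theta}}_n\in\mathbb{K}\right)=0.$$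
   Context: Write $[g]=\{1,\dots,g\}$. For $\theta\in(0,1)$ the triangular density on $[0,1]$ is $f(x;\theta)=2x/\theta$ if $x<\theta$ and $f(x;\theta)=2(1-x)/(1-\theta)$ if $x\ge\theta$; moreover $f(x;0)=2(1-x)$ and $f(x;1)=2x$. The parameter space is $$\Theta_g=\Big\{\boldsymbol{\theta}^\top=(\pi_1,\dots,\pi_g,\theta_1,\dots,\theta_g):\pi_i\ge0,\ \sum_{i=1}^g\pi_i=1,\ \theta_i\in[0,1],\ i\in[g]\Big\},$$ and the polygonal density with $g$ components and parameter $\boldsymbol{\theta}\in\Theta_g$ is $f(x;\boldsymbol{\theta})=\sum_{i=1}^g\pi_i f(x;\theta_i)$, $x\in[0,1]$. The log-likelihood is $L(\boldsymbol{\theta};\boldsymbol{X}_n)=\sum_{j=1}^n\log f(X_j;\boldsymbol{\theta})$ (with $\log 0=-\infty$). Define $$\Theta_g^0=\Big\{\boldsymbol{\theta}\in\Theta_g:E[L(\boldsymbol{\theta};\boldsymbol{X}_n)]=\sup_{\boldsymbol{v}\in\Theta_g}E[L(\boldsymbol{v};\boldsymbol{X}_n)]\Big\},\qquad \Theta_g^n=\Big\{\boldsymbol{\theta}\in\Theta_g:L(\boldsymbol{\theta};\boldsymbol{X}_n)=\sup_{\boldsymbol{v}\in\Theta_g}L(\boldsymbol{v};\boldsymbol{X}_n)\Big\},$$ where $E$ is expectation under the true density $f(\cdot;\boldsymbol{\theta}_0)$; since $E[L(\boldsymbol{\theta};\boldsymbol{X}_n)]=n\,E[\log f(X_1;\boldsymbol{\theta})]$,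 the set $\Theta_g^0$ does not depend on $n$. $\|\cdot\|_2$ is the Euclidean norm. *)

(* Defs.v *)
From HB Require Import structures.
From mathcomp Require Import all_boot all_order all_algebra finmap.
From mathcomp Require Import all_classical all_reals all_analysis.
Import Order.TTheory GRing.Theory Num.Theory.
Import numFieldNormedType.Exports.

Set Implicit Arguments.
Unset Strict Implicit.
Unset Printing Implicit Defensive.

Local Open Scope classical_set_scope.
Local Open Scope ring_scope.

(* The endpoint [t = 1] needs its own branch: the generic formula would give
   [tri_density 1 1 = 0] (as [0 / 0 = 0]) instead of [2].  Densities on [0, 1]
   are extended by [0] to the real line. *)
Definition tri_density (R : realType) (t x : R) : R :=
  if 0 <= x <= 1 then
    if t == 0 then 2 * (1 - x)
    else if t == 1 then 2 * x
    else if x < t then 2 * x / t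
    else 2 * (1 - x) / (1 - t)
  else 0.

(* A parameter (pi_1, ..., pi_g, theta_1, ..., theta_g) is a row vector of
   length [g + g]. *)
Definition weight (R : realType) (g : nat) (v : 'rV[R]_(g + g)) (i : 'I_g) : R :=
  v 0 (lshift g i).

Definition peak (R : realType) (g : nat) (v : 'rV[R]_(g + g)) (i : 'I_g) : R :=
  v 0 (rshift g i).

Definition Theta (R : realType) (g : nat) : set 'rV[R]_(g + g) :=
  [set v | [/\ forall i, 0 <= weight v i,
               \sum_(i < g) weight v i = 1
             & forall i, 0 <= peak v i <= 1]].
Arguments Theta : clear implicits.

Definition poly_density (R : realType) (g : nat) (v : 'rV[R]_(g + g)) (x : R) : R :=
  \sum_(i < g) weight v i * tri_density (peak v i) x.

(* [lne 0 = -oo], and no summand is [+oo], so the sum is unambiguous. *)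
Definition loglik (R : realType) (g n : nat) (v : 'rV[R]_(g + g))
    (x : n.-tuple R) : \bar R :=
  (\sum_(j < n) lne (poly_density v (tnth x j))%:E)%E.

(* The observations X_1, X_2, ... are indexed from [0]. *)
Definition sample d (T : measurableType d) (R : realType) (P : probability T R)
    (X : nat -> {RV P >-> R}) (n : nat) (w : T) : n.-tuple R :=
  [tuple X (nat_of_ord j) w | j < n].

(* The integrand is bounded above, so the integral is well defined, possibly
   equal to [-oo]. *)
Definition mean_loglik d (T : measurableType d) (R : realType)
    (P : probability T R) (X : nat -> {RV P >-> R}) (g n : nat)
    (v : 'rV[R]_(g + g)) : \bar R :=
  (\int[P]_w loglik v (sample X n w))%E.

Definition Theta_mean d (T : measurableType d) (R : realType)
    (P : probability T R) (X : nat -> {RV P >-> R}) (g n : nat) :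
    set 'rV[R]_(g + g) :=
  [set v | Theta R g v /\
    mean_loglik X n v = ereal_sup [set mean_loglik X n u | u in Theta R g]].
Arguments Theta_mean {d T R P} X g n.

Definition Theta_mle (R : realType) (g n : nat) (x : n.-tuple R) :
    set 'rV[R]_(g + g) :=
  [set v | Theta R g v /\
    loglik v x = ereal_sup [set loglik u x | u in Theta R g]].
Arguments Theta_mle {R} g {n} x.

(* The default norm on matrices is the sup norm. *)
Definition norm2 (R : realType) (k : nat) (v : 'rV[R]_k) : R :=
  Num.sqrt (\sum_(i < k) v 0 i ^+ 2).

Definition mutually_independent d (T : measurableType d) (R : realType)
    (P : probability T R) (X : nat -> {RV P >-> R}) : Prop :=
  forall (J : {fset nat}) (A : nat -> set R),
    (forall j, measurable (A j)) ->
    P (\bigcap_(j in [set` J]) (X j @^-1` A j)) =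
    (\prod_(j <- J) P (X j @^-1` A j))%E.

Definition has_density d (T : measurableType d) (R : realType)
    (P : probability T R) (Y : {RV P >-> R}) (f : R -> R) : Prop :=
  forall A : set R, measurable A ->
    distribution P Y A = (\int[lebesgue_measure]_(x in A) (f x)%:E)%E.

Definition borel_measurable (R : realType) (n k : nat)
    (t : n.-tuple R -> 'rV[R]_k) : Prop :=
  forall B : set 'rV[R]_k, <<s [set U : set 'rV[R]_k | open U] >> B ->
    measurable (t @^-1` B).

(* Main.v *)
Require Import Defs.
From HB Require Import structures.
From mathcomp Require Import all_boot all_order all_algebra finmap.
From mathcomp Require Import all_classical all_reals all_analysis.
From mathcomp Require Import measurable_realfun ring lra.
Import Order.TTheory GRing.Theory Num.Theory.
Import numFieldNormedType.Exports HBNNSimple.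

Set Implicit Arguments.
Unset Strict Implicit.
Unset Printing Implicit Defensive.

Local Open Scope classical_set_scope.
Local Open Scope ring_scope.

(** Wald's argument, run with square roots of likelihood ratios instead of
    logarithms, so that neither a law of large numbers nor the integrability of
    [log f] is needed.  If [v] is not a maximizer of the mean log-likelihood, then
    [f(.; v)] and [f(.; theta0)] are distinct densities, so their Hellinger
    affinity, the integral of [sqrt (f(.; v) f(.; theta0))], is less than [1].
    On a small neighbourhood of [v] all the [sqrt f(.; v')] lie below one function
    [q] such that the integral [rho] of [q sqrt f(.; theta0)] is still less than
    [1].  If the maximum likelihood estimator lies in that neighbourhood, then the
    product of the [q / sqrt f(.; theta0)] over the sample is at least [1], and by
    independence and Markov's inequality this has probability at most [rho ^ n].
    Compactness reduces the event to finitely many such neighbourhoods. *)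

(** * Triangular densities *)

(* Continuous on the whole line, unlike [tri_density], which jumps at [0] when
   [t = 0] and at [1] when [t = 1]. *)
Definition tri_line {R : realType} (t x : R) : R :=
  if t == 0 then 2 * (1 - x)
  else if t == 1 then 2 * x
  else Num.min (2 * x / t) (2 * (1 - x) / (1 - t)).

(** For [0 < t < 1], clearing denominators turns [2 * x / t <= 2 * (1 - x) / (1 - t)] into [x <= t],
    so the minimum selects the branch that the density uses. *)
Lemma tri_densityE (R : realType) (t x : R) :
  0 <= t <= 1 -> 0 <= x <= 1 -> tri_density t x = tri_line t x.
Proof.
move=> /andP[t0 t1] x01; rewrite /tri_density /tri_line x01.
have [//|tn0] := eqVneq t 0; have [//|tn1] := eqVneq t 1.
have tp : 0 < t by rewrite lt_def tn0.
have tl : 0 < 1 - t by rewrite subr_gt0 lt_neqAle tn1.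
have [xt|tx] := ltP x t.
  rewrite min_l// ler_pdivrMr// mulrAC ler_pdivlMr//; nra.
rewrite min_r// ler_pdivrMr// mulrAC ler_pdivlMr//; nra.
Qed.

Lemma continuous_tri_line (R : realType) (t : R) : continuous (tri_line t).
Proof.
move=> x; rewrite /tri_line.
have H1 : {for x, continuous (fun x : R => 2 * (1 - x))}.
  by apply: cvgM; [exact: cvg_cst|apply: cvgB; [exact: cvg_cst|exact: cvg_id]].
have H2 : {for x, continuous (fun x : R => 2 * x)}.
  by apply: cvgM; [exact: cvg_cst|exact: cvg_id].
case: eqVneq => _; first exact: H1.
case: eqVneq => _; first exact: H2.
by apply: (@continuous_min R R (fun x => 2 * x / t) (fun x => 2 * (1 - x) / (1 - t)));
  apply: cvgM => //; exact: cvg_cst.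
Qed.

Lemma tri_density_ge0 (R : realType) (t x : R) :
  0 <= t <= 1 -> 0 <= tri_density t x.
Proof.
move=> /andP[t0 t1]; rewrite /tri_density; case: ifP => // /andP[x0 x1].
do 2 (case: ifP => _; first by lra).
by case: ifP => _; rewrite divr_ge0//; lra.
Qed.

Lemma tri_density_le2 (R : realType) (t x : R) :
  0 <= t <= 1 -> tri_density t x <= 2.
Proof.
move=> /andP[t0 t1]; rewrite /tri_density; case: ifP => // /andP[x0 x1].
case: eqVneq => [_|tn0]; first by lra.
case: eqVneq => [_|tn1]; first by lra.
have tp : 0 < t by rewrite lt_def tn0.
have tl : 0 < 1 - t by rewrite subr_gt0 lt_neqAle tn1.
by case: ltP => xt; rewrite ler_pdivrMr//; lra.
Qed.

(** On either branch the denominator is at least the distance from [x] to an edge, hence at least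
    [dl]. The margin [dl] cannot be dropped: at [x = 0] the density is 2 for the peak 0 and 0 for
    every positive peak. *)
Lemma tri_density_lip (R : realType) (dl s t x : R) :
  0 < dl -> dl <= x <= 1 - dl -> 0 <= s <= 1 -> 0 <= t <= 1 ->
  `|tri_density s x - tri_density t x| <= 2 / dl * `|s - t|.
Proof.
move=> dl0 /andP[x0 x1].
(* Since [0 < x < 1], the peaks 0 and 1 also fit the two generic branches. *)
have triE u : 0 <= u <= 1 ->
    tri_density u x = if x < u then 2 * x / u else 2 * (1 - x) / (1 - u).
  move=> /andP[u0 u1]; rewrite /tri_density ifT; last by apply/andP; split; lra.
  case: eqVneq => [->|_]; last first.
    by case: eqVneq => [->|//]; rewrite ifT ?divr1//; lra.
  by rewrite ifF ?subr0 ?divr1//; apply/negbTE; rewrite -leNgt; lra.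
wlog st : s t / s <= t.
  move=> H s01 t01; have [st|/ltW ts] := leP s t; first exact: H.
  by rewrite distrC (distrC s t); exact: H.
move=> s01 t01; rewrite !triE//.
move: s01 t01 => /andP[s0 s1] /andP[t0 t1].
have -> : `|s - t| = t - s by rewrite distrC ger0_norm// subr_ge0.
rewrite [leRHS]mulrAC ler_pdivlMr//.
have [xs|sx] := ltP x s.
  have sp : 0 < s by lra.
  have tp : 0 < t by lra.
  rewrite (lt_le_trans xs st).
  have -> : 2 * x / s - 2 * x / t = 2 * (x / s) * ((t - s) / t) by field; lra.
  have h1 : x / s <= 1 by rewrite ler_pdivrMr//; lra.
  have h2 : 0 <= x / s by rewrite divr_ge0//; lra.
  have h3 : 0 <= (t - s) / t by rewrite divr_ge0//; lra.
  have h4 : (t - s) / t * t = t - s by rewrite divfK//; lra.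
  rewrite ger0_norm; last by apply: mulr_ge0 => //; apply: mulr_ge0.
  set a := x / s in h1 h2 *; set b := (t - s) / t in h3 h4 *.
  have : b * dl <= t - s by rewrite -h4; nra.
  have : a * (b * dl) <= b * dl by rewrite ler_piMl// mulr_ge0// ltW.
  lra.
have sp : 0 < 1 - s by lra.
have [xt|tx] := ltP x t.
  have tp : 0 < t by lra.
  (* Here [s <= x < t]. Both values are written as deficits from the peak height 2; multiplied by
     [dl], the deficits are at most [2 * (x - s)] and [2 * (t - x)], which add up to
     [2 * (t - s)]. *)
  have -> : 2 * (1 - x) / (1 - s) - 2 * x / t =
    2 * ((t - x) / t) - 2 * ((x - s) / (1 - s)) by field; lra.
  set a := (t - x) / t; set b := (x - s) / (1 - s).
  have a0 : 0 <= a by rewrite divr_ge0//; lra.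
  have b0 : 0 <= b by rewrite divr_ge0//; lra.
  have aE : a * t = t - x by rewrite divfK//; lra.
  have bE : b * (1 - s) = x - s by rewrite divfK//; lra.
  have ha : a * dl <= t - x by rewrite -aE; nra.
  have hb : b * dl <= x - s by rewrite -bE; nra.
  rewrite -ler_pdivlMr// ler_norml -mulNr !ler_pdivlMr ?ler_pdivrMr//.
  by apply/andP; split; nra.
have tp : 0 < 1 - t by lra.
have -> : 2 * (1 - x) / (1 - s) - 2 * (1 - x) / (1 - t) =
   - (2 * ((1 - x) / (1 - t)) * ((t - s) / (1 - s))) by field; lra.
rewrite normrN.
have h1 : (1 - x) / (1 - t) <= 1 by rewrite ler_pdivrMr//; lra.
have h2 : 0 <= (1 - x) / (1 - t) by rewrite divr_ge0//; lra.
have h3 : 0 <= (t - s) / (1 - s) by rewrite divr_ge0//; lra.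
have h4 : (t - s) / (1 - s) * (1 - s) = t - s by rewrite divfK//; lra.
rewrite ger0_norm; last by apply: mulr_ge0 => //; apply: mulr_ge0.
set a := (1 - x) / (1 - t) in h1 h2 *; set b := (t - s) / (1 - s) in h3 h4 *.
have : b * dl <= t - s by rewrite -h4; nra.
have : a * (b * dl) <= b * dl by rewrite ler_piMl// mulr_ge0// ltW.
lra.
Qed.

(** * Integrals over segments and the unit mass of triangular densities *)

Lemma continuous_integrable_itv (R : realType) (f : R -> R) (a b : R) :
  continuous f -> (@lebesgue_measure R).-integrable `[a, b] (EFin \o f).
Proof.
move=> cf; apply: continuous_compact_integrable; first exact: segment_compact.
exact: continuous_subspaceT.
Qed.

Lemma continuous_lin_comb (R : realType) (I : Type) (s : seq I) (c : I -> R)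
    (f : I -> R -> R) : (forall i, continuous (f i)) ->
  continuous (fun x => \sum_(i <- s) c i * f i x).
Proof.
move=> cf; apply: (@continuous_big _ _ +%R 0 xpredT _ _ s (fun i x => c i * f i x)) => [|i _ x].
  exact: add_continuous.
by apply: cvgM; [exact: cvg_cst|exact: cf].
Qed.

Lemma Rintegral_lin_comb (R : realType) (I : Type) (s : seq I) (c : I -> R)
    (f : I -> R -> R) (a b : R) : (forall i, continuous (f i)) ->
  \int[@lebesgue_measure R]_(x in `[a, b]) (\sum_(i <- s) c i * f i x) =
  \sum_(i <- s) c i * \int[@lebesgue_measure R]_(x in `[a, b]) f i x.
Proof.
move=> cf; have cZ i : continuous (fun x => c i * f i x).
  by move=> x; apply: cvgM; [exact: cvg_cst|exact: cf].
elim: s => [|i s IH].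
  rewrite big_nil (@eq_Rintegral _ _ _ _ _ (fun=> 0)) ?Rintegral_cst ?mul0r//.
  by move=> x _; rewrite big_nil.
rewrite big_cons -IH -RintegralZl//; last exact: continuous_integrable_itv.
rewrite -RintegralD//; [|exact: continuous_integrable_itv|].
  by apply: eq_Rintegral => x _; rewrite big_cons.
by apply: continuous_integrable_itv; apply: continuous_lin_comb.
Qed.

Lemma Rintegral_affine (R : realType) (p q a b : R) : a < b ->
  \int[@lebesgue_measure R]_(x in `[a, b]) (p + q * x) =
  p * (b - a) + q / 2 * (b ^+ 2 - a ^+ 2).
Proof.
move=> ab; rewrite /Rintegral.
pose F : R -> R := fun x => p * x + q / 2 * x ^+ 2.
have dF (x : R) : is_derive x (1 : R) (F : R -> R) (p + q * x).
  apply: is_deriveD; first by apply: is_derive_eq; rewrite ?scaler1 /GRing.scale /=; lra.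
  by apply: is_derive_eq; rewrite /GRing.scale /=; field.
have cF : continuous F.
  by move=> x; apply/differentiable_continuous/derivable1_diffP; apply: ex_derive.
rewrite (@continuous_FTC2 _ _ F)//.
- by rewrite /F /=; lra.
- apply: continuous_subspaceT => x; apply: cvgD; first exact: cvg_cst.
  by apply: cvgM; [exact: cvg_cst|exact: cvg_id].
- split.
  + by move=> x _; apply: ex_derive.
  + by apply: cvg_at_right_filter; exact: cF.
  + by apply: cvg_at_left_filter; exact: cF.
- by move=> x _; rewrite derive1E; apply: derive_val.
Qed.

Lemma Rintegral_tri_line (R : realType) (t : R) : 0 <= t <= 1 ->
  \int[@lebesgue_measure R]_(x in `[0, 1]) tri_line t x = 1.
Proof.
move=> /andP[t0 t1].
have [t0'|tn0] := eqVneq t 0.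
  transitivity (\int[@lebesgue_measure R]_(x in `[0, 1]) (2 + (-2) * x)).
    by apply: eq_Rintegral => x _; rewrite /tri_line t0' eqxx; lra.
  by rewrite Rintegral_affine//; lra.
have [t1'|tn1] := eqVneq t 1.
  transitivity (\int[@lebesgue_measure R]_(x in `[0, 1]) (0 + 2 * x)).
    by apply: eq_Rintegral => x _; rewrite /tri_line t1' eqxx oner_eq0; lra.
  by rewrite Rintegral_affine//; lra.
have tp : 0 < t by rewrite lt_def tn0.
have tl : t < 1 by rewrite lt_neqAle tn1.
have tl' : 0 < 1 - t by rewrite subr_gt0.
have itri a b := @continuous_integrable_itv R _ a b (@continuous_tri_line R t).
(* The integral is cut at the peak, so that each piece has an affine integrand; the right piece
   first appears half-open. *)
have /(congr1 (fun y => y + \int[lebesgue_measure]_(x in `[0, t]) tri_line t x)) :=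
  @Rintegral_itvB R (tri_line t) (BLeft 0) (BRight 1) t (itri 0 1)
   ltac:(by rewrite bnd_simp) ltac:(by rewrite bnd_simp).
rewrite subrK => ->.
rewrite Rintegral_itv_obnd_cbnd; last first.
  by apply: integrableS (itri t 1) => //; exact: subset_itv_oc_cc.
have -> : \int[@lebesgue_measure R]_(x in `[t, 1]) tri_line t x =
    \int[@lebesgue_measure R]_(x in `[t, 1]) (2 / (1 - t) + (- 2 / (1 - t)) * x).
  apply: eq_Rintegral => x; rewrite inE/= in_itv/= => /andP[x0 x1].
  rewrite /tri_line (negbTE tn0) (negbTE tn1) min_r; first by field; lra.
  rewrite ler_pdivrMr// mulrAC ler_pdivlMr//; nra.
have -> : \int[@lebesgue_measure R]_(x in `[0, t]) tri_line t x =
    \int[@lebesgue_measure R]_(x in `[0, t]) (0 + (2 / t) * x).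
  apply: eq_Rintegral => x; rewrite inE/= in_itv/= => /andP[x0 x1].
  rewrite /tri_line (negbTE tn0) (negbTE tn1) min_l; first by field; lra.
  rewrite ler_pdivrMr// mulrAC ler_pdivlMr//; nra.
by rewrite !Rintegral_affine//; field; lra.
Qed.

(** * Polygonal densities *)

Definition poly_line {R : realType} {g : nat} (v : 'rV[R]_(g + g)) (x : R) : R :=
  \sum_(i < g) weight v i * tri_line (peak v i) x.

Section poly_line.
Context {R : realType} {g : nat}.
Implicit Types v u : 'rV[R]_(g + g).

Lemma poly_densityE v x : Theta R g v ->
  poly_density v x = if 0 <= x <= 1 then poly_line v x else 0.
Proof.
move=> [w0 w1 p01]; rewrite /poly_density /poly_line.
case: ifPn => x01; first by apply: eq_bigr => i _; rewrite tri_densityE.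
by rewrite big1// => i _; rewrite /tri_density (negbTE x01) mulr0.
Qed.

Lemma continuous_poly_line v : continuous (poly_line v).
Proof.
by apply: continuous_lin_comb => i; exact: continuous_tri_line.
Qed.

Lemma poly_density_ge0 v x : Theta R g v -> 0 <= poly_density v x.
Proof.
move=> [w0 w1 p01]; apply: sumr_ge0 => i _; apply: mulr_ge0 => //.
exact: tri_density_ge0.
Qed.

Lemma poly_density_le2 v x : Theta R g v -> poly_density v x <= 2.
Proof.
move=> [w0 w1 p01]; rewrite [leRHS](_ : _ = \sum_i weight v i * 2); last first.
  by rewrite -mulr_suml w1 mul1r.
apply: ler_sum => i _.
by apply: ler_wpM2l => //; exact: tri_density_le2.
Qed.

Lemma Rintegral_poly_line v : Theta R g v ->
  \int[@lebesgue_measure R]_(x in `[0, 1]) poly_line v x = 1.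
Proof.
move=> [w0 w1 p01]; rewrite /poly_line Rintegral_lin_comb => [|i].
  rewrite -[RHS]w1; apply: eq_bigr => i _; rewrite -[RHS]mulr1; congr (_ * _).
  exact: Rintegral_tri_line.
exact: continuous_tri_line.
Qed.

End poly_line.

(** * Expectations of products over an independent sample *)

Lemma prod_indic (R : realType) (T : Type) (n : nat) (B : 'I_n -> set T) (w : T) :
  \prod_(j < n) \1_(B j) w = \1_(\bigcap_j B j) w :> R.
Proof.
rewrite [RHS]indicE; case: (pselect ((\bigcap_j B j) w)) => Bw.
  rewrite mem_set//= big1// => j _; rewrite indicE mem_set//; exact: Bw.
rewrite memNset//=; have [j nBj] : exists j, ~ B j w.
  by apply: contrapT => /forallNP H; apply: Bw => j _; exact: contrapT (H j).
by rewrite (bigD1 j)//= indicE memNset// mul0r.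
Qed.

Lemma mutually_independent_ord d (T : measurableType d) (R : realType)
    (P : probability T R) (X : nat -> {RV P >-> R}) (n : nat)
    (A : 'I_n -> set R) : mutually_independent X ->
  (forall j, measurable (A j)) ->
  P (\bigcap_(j : 'I_n) (X j @^-1` A j)) = (\prod_(j < n) P (X j @^-1` A j))%E.
Proof.
move=> Xi mA; pose J := [fset k in iota 0 n]%fset.
(* Independence asks for a measurable set at every natural index, so the family is continued by the
   whole space. *)
pose A' k : set R := if insub k is Some j then A j else setT.
have A'E (j : 'I_n) : A' j = A j by rewrite /A' valK.
have mA' k : measurable (A' k) by rewrite /A'; case: insubP.
have := Xi J A' mA'.
have -> : (\prod_(j <- J) P (X j @^-1` A' j) = \prod_(j < n) P (X j @^-1` A j))%E.
  rewrite (perm_big (index_iota 0 n)) ?big_mkord; first last.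
    apply: uniq_perm => [||k]; first exact: fset_uniq.
    - exact: iota_uniq.
    - by rewrite /J in_fset/= mem_index_iota mem_iota add0n.
  by apply: eq_bigr => j _; rewrite A'E.
move=> <-; congr (P _); apply/seteqP; split=> w Aw.
  move=> k; rewrite /= in_fset/= mem_iota/= => kn.
  by rewrite -[k]/(val (Ordinal kn)) A'E; exact: Aw.
move=> j _; rewrite -A'E; apply: Aw => /=.
by rewrite in_fset/= mem_iota/=.
Qed.

(** Distributing the product over the sums gives one term per map from ['I_n] to ['I_N], each a
    constant times the indicator of an intersection. Independence factors its probability, and
    distributivity read backwards collects the power. *)
Lemma expectation_prod_simple d (T : measurableType d) (R : realType)
    (P : probability T R) (X : nat -> T -> R) (n N : nat)
    (c : 'I_N -> R) (A : 'I_N -> set R) :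
  (forall j, measurable_fun setT (X j)) ->
  (forall B : 'I_n -> set R, (forall j, measurable (B j)) ->
     P (\bigcap_(j : 'I_n) (X j @^-1` B j)) = \prod_(j < n) P (X j @^-1` B j))%E ->
  (forall j (B : set R), measurable B -> P (X j @^-1` B) = P (X 0 @^-1` B)) ->
  (forall i, 0 <= c i) -> (forall i, measurable (A i)) ->
  (\int[P]_w (\prod_(j < n) \sum_(i < N) c i * \1_(A i) (X j w))%:E =
   ((\sum_(i < N) c i * fine (P (X 0 @^-1` A i))) ^+ n)%:E)%E.
Proof.
move=> mX Xi Xid c0 mA.
have mXA j i : measurable (X j @^-1` A i) by rewrite -[X in measurable X]setTI; exact: mX.
under eq_integral => w _.
  rewrite bigA_distr_bigA/=.
  under eq_bigr => s _.
    rewrite big_split/= (@prod_indic _ _ _ (fun j => X j @^-1` A (s j))).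
    over.
  rewrite -sumEFin; over.
have mB (s : {ffun 'I_n -> 'I_N}) : measurable (\bigcap_(j : 'I_n) (X j @^-1` A (s j))).
  by apply: fin_bigcap_measurable => //; exact: finite_finset.
rewrite ge0_integral_sum//=; last 2 first.
- by move=> s; apply/measurable_EFinP; apply: measurable_funM.
- by move=> s w _; rewrite lee_fin mulr_ge0// prodr_ge0.
(* The power is viewed as a product of [n] equal sums and expanded over the same maps. *)
rewrite -[in RHS](card_ord n) -prodr_const bigA_distr_bigA/= -sumEFin.
apply: eq_bigr => s _.
under eq_integral do rewrite EFinM.
rewrite ge0_integralZl//=; last 2 first.
- by apply/measurable_EFinP.
- by rewrite lee_fin prodr_ge0.
rewrite integral_indic// setIT.
have /= -> := Xi (fun j => A (s j)) (fun=> mA _).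
have pE (j : 'I_n) : true ->
    P (X j @^-1` A (s j)) = (fine (P (X 0 @^-1` A (s j))))%:E.
  by rewrite fineK ?fin_num_measure// => _; exact: Xid.
rewrite (eq_bigr _ pE).
by rewrite prodEFin -EFinM -big_split.
Qed.

Lemma nnsfun_indic_sum d (T : measurableType d) (R : realType)
    (s : {nnsfun T >-> R}) : exists (N : nat) (c : 'I_N -> R) (A : 'I_N -> set T),
  [/\ forall i, 0 <= c i, forall i, measurable (A i) &
      forall x, s x = \sum_(i < N) c i * \1_(A i) x].
Proof.
pose l := fset_set (range s).
exists (size l), (fun i => l`_i), (fun i => s @^-1` [set l`_i]); split => [i||x].
- have : l`_i \in l by exact: mem_nth.
  by rewrite in_fset_set; [rewrite inE => -[x _ <-]|exact: fimfunP].
- by move=> i; exact: measurable_sfunP.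
by rewrite fimfunE fsbig_finite//= (big_nth 0) big_mkord.
Qed.

Lemma nnsfun_approximation d (T : measurableType d) (R : realType) (r : T -> R) :
  measurable_fun setT r -> (forall x, 0 <= r x) ->
  exists s : {nnsfun T >-> R}^nat,
  [/\ forall x, s k x @[k --> \oo] --> r x,
      forall x, nondecreasing_seq (fun k => s k x) &
      forall k x, s k x <= r x].
Proof.
move=> mr r0; have mrE : measurable_fun setT (EFin \o r) by apply/measurable_EFinP.
pose s := nnsfun_approx measurableT mrE.
have s_cvg x : s k x @[k --> \oo] --> r x.
  have r0E y : setT y -> (0 <= (EFin \o r) y)%E by rewrite lee_fin.
  by have /fine_cvg := cvg_nnsfun_approx measurableT mrE r0E (x := x) I.
have s_nd x : nondecreasing_seq (fun k => s k x).
  by move=> a b ab; exact/lefP/nd_nnsfun_approx.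
exists s; split => // k x; have /cvg_lim <- // := s_cvg x.
by apply: (nondecreasing_cvgn_le (s_nd x)); apply/cvg_ex; exists (r x).
Qed.

(** The simple case passes to the limit by monotone convergence: products of nonnegative
    nondecreasing sequences are nondecreasing. *)
Lemma expectation_prod_le d (T : measurableType d) (R : realType)
    (P : probability T R) (X : nat -> T -> R) (r : R -> R) (rho : R) (n : nat) :
  (forall j, measurable_fun setT (X j)) ->
  (forall k (B : 'I_k -> set R), (forall j, measurable (B j)) ->
     P (\bigcap_(j : 'I_k) (X j @^-1` B j)) = \prod_(j < k) P (X j @^-1` B j))%E ->
  (forall j (B : set R), measurable B -> P (X j @^-1` B) = P (X 0 @^-1` B)) ->
  measurable_fun setT r -> (forall x, 0 <= r x) ->
  (\int[P]_w (r (X 0 w))%:E <= rho%:E)%E ->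
  (\int[P]_w (\prod_(j < n) r (X j w))%:E <= (rho ^+ n)%:E)%E.
Proof.
move=> mX Xi Xid mr r0 rrho.
have mrE : measurable_fun setT (EFin \o r) by apply/measurable_EFinP.
have [s [s_cvg s_nd s_le]] := nnsfun_approximation mr r0.
have mprod (h : R -> R) k : measurable_fun setT h ->
    measurable_fun setT (fun w => (\prod_(j < k) h (X j w))%:E).
  move=> mh; apply/measurable_EFinP; apply: measurable_prod => j _.
  exact: (measurableT_comp mh).
have step k : (\int[P]_w (\prod_(j < n) s k (X j w))%:E <= (rho ^+ n)%:E)%E.
  have [N [c [A [c0 mA sE]]]] := nnsfun_indic_sum (s k).
  have E m := @expectation_prod_simple _ _ _ P X m N c A mX (Xi m) Xid c0 mA.
  under eq_integral do under eq_bigr do rewrite sE.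
  rewrite E lee_fin lerXn2r ?nnegrE//.
  - by apply: sumr_ge0 => i _; rewrite mulr_ge0// fine_ge0.
  - by rewrite -lee_fin (le_trans _ rrho)// integral_ge0// => w _; rewrite lee_fin.
  (* For a single factor, the same formula identifies the base of the power with the expectation of
     [s k (X 0 w)], which is at most that of [r (X 0 w)]. *)
  have := E 1; under eq_integral do under eq_bigr do rewrite -sE.
  rewrite expr1 -lee_fin => <-.
  apply: le_trans rrho; apply: ge0_le_integral => //.
  - by move=> w _; rewrite lee_fin big_ord1.
  - exact: mprod.
  - by apply: (measurableT_comp mrE).
  - by move=> w _; rewrite lee_fin big_ord1.
have prod_cvg w : (\prod_(j < n) s k (X j w))%:E @[k --> \oo] -->
    (\prod_(j < n) r (X j w))%:E.
  apply: cvg_EFin; first exact: nearW.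
  exact: (@cvg_big R 'I_n *%R 1 xpredT (@mul_continuous _) nat \oo _
    (fun j k => s k (X j w)) (fun j => r (X j w)) _ (fun j _ => s_cvg _)).
have : (\int[P]_w (\prod_(j < n) s k (X j w))%:E @[k --> \oo] -->
    \int[P]_w (\prod_(j < n) r (X j w))%:E)%E.
  have lE w : limn (EFin \o (fun k => \prod_(j < n) s k (X j w))) =
      (\prod_(j < n) r (X j w))%:E by apply/cvg_lim => //; exact: prod_cvg.
  under [X in _ --> X]eq_integral do rewrite -lE.
  apply: cvg_monotone_convergence => //.
  - by move=> k; exact: mprod.
  - by move=> k w _; rewrite lee_fin prodr_ge0.
  - by move=> w _ a b ab; rewrite lee_fin ler_prod// => j _; rewrite s_nd// fun_ge0.
by move=> icvg; apply: (cvge_le _ icvg); exact: nearW.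
Qed.

(** Change of variables to the density. For simple functions it is linearity together with [fE];
    since these lie below [r], the right-hand side bounds them all, and only the left-hand side has
    to be passed to the limit. *)
Lemma integral_density_le d (T : measurableType d) (R : realType)
    (P : probability T R) (Y : T -> R) (f r : R -> R) :
  measurable_fun setT Y -> measurable_fun setT f -> (forall x, 0 <= f x) ->
  (forall A : set R, measurable A ->
     P (Y @^-1` A) = \int[lebesgue_measure]_(x in A) (f x)%:E)%E ->
  measurable_fun setT r -> (forall x, 0 <= r x) ->
  (\int[P]_w (r (Y w))%:E <= \int[lebesgue_measure]_x (r x * f x)%:E)%E.
Proof.
move=> mY mf f0 fE mr r0.
have [s [s_cvg s_nd s_le]] := nnsfun_approximation mr r0.
have msk k : measurable_fun setT (s k) by [].
have msY k : measurable_fun setT (fun w => (s k (Y w))%:E).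
  by apply/measurable_EFinP; exact: measurableT_comp.
have step k : (\int[P]_w (s k (Y w))%:E <= \int[lebesgue_measure]_x (r x * f x)%:E)%E.
  have [N [c [A [c0 mA sE]]]] := nnsfun_indic_sum (s k).
  have mYA i : measurable (Y @^-1` A i) by rewrite -[X in measurable X]setTI; exact: mY.
  have m1 i : measurable_fun setT (\1_(A i) : R -> R) by apply: measurable_indic.
  have mF i : measurable_fun setT (fun x : R => c i * \1_(A i) x).
    by apply: measurable_funM => //; exact: m1.
  have sYE w : s k (Y w) = \sum_(i < N) c i * \1_(Y @^-1` A i) w := sE (Y w).
  under eq_integral do rewrite sYE -sumEFin.
  rewrite ge0_integral_sum//; last 2 first.
  - by move=> i; apply/measurable_EFinP; apply: measurable_funM.
  - by move=> i w _; rewrite lee_fin mulr_ge0.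
  apply: (@le_trans _ _ (\int[lebesgue_measure]_x (s k x * f x)%:E)%E); last first.
    apply: ge0_le_integral => //.
    - by move=> x _; rewrite lee_fin mulr_ge0.
    - by apply/measurable_EFinP; apply: measurable_funM; [exact: msk|exact: mf].
    - by apply/measurable_EFinP; apply: measurable_funM; [exact: mr|exact: mf].
    - by move=> x _; rewrite lee_fin ler_wpM2r.
  under [leRHS]eq_integral do rewrite sE mulr_suml -sumEFin.
  rewrite ge0_integral_sum//; last 2 first.
  - by move=> i; apply/measurable_EFinP; apply: measurable_funM; [exact: mF|exact: mf].
  - by move=> i x _; rewrite lee_fin !mulr_ge0.
  apply: lee_sum => i _.
  under eq_integral do rewrite EFinM.
  rewrite ge0_integralZl//=; last 2 first.
  - by apply/measurable_EFinP.
  - by rewrite lee_fin.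
  under [leRHS]eq_integral do rewrite -mulrA EFinM.
  rewrite ge0_integralZl//=; last 3 first.
  - by apply/measurable_EFinP; apply: measurable_funM; [exact: m1|exact: mf].
  - by move=> x _; rewrite lee_fin mulr_ge0.
  - by rewrite lee_fin.
  apply: lee_wpmul2l; first by rewrite lee_fin.
  rewrite integral_indic// setIT.
  apply: le_trans (_ : _ <= \int[lebesgue_measure]_(x in A i) (f x)%:E)%E _.
    by rewrite -fE.
  rewrite [leLHS]integral_mkcond/= epatch_indic/=.
  by under eq_integral do rewrite -EFinM mulrC.
have lE w : limn (EFin \o (fun k => s k (Y w))) = (r (Y w))%:E.
  apply/cvg_lim => //; apply: cvg_EFin; first exact: nearW.
  exact: s_cvg.
have icvg : (\int[P]_w (s k (Y w))%:E @[k --> \oo] --> \int[P]_w (r (Y w))%:E)%E.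
  under [X in _ --> X]eq_integral do rewrite -lE.
  apply: cvg_monotone_convergence => //.
  - by move=> k w _; rewrite lee_fin.
  - by move=> w _ a b ab; rewrite lee_fin; exact: s_nd.
by apply: (cvge_le _ icvg); exact: nearW.
Qed.

(** * Exponential tail of likelihood ratios *)

(** Markov's inequality at threshold 1 for the product of the ratios [q / sqrt f], whose common mean
    is at most the integral of [q * sqrt f]. Comparing two products instead of a quotient with 1
    keeps the event meaningful where [f] vanishes. *)
Lemma likelihood_ratio_tail d (T : measurableType d) (R : realType)
    (P : probability T R) (X : nat -> {RV P >-> R}) (f q : R -> R) (rho : R)
    (n : nat) :
  mutually_independent X -> (forall j, has_density (X j) f) ->
  measurable_fun setT f -> (forall x, 0 <= f x) ->
  measurable_fun setT q -> (forall x, 0 <= q x) ->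
  (\int[lebesgue_measure]_x (q x * Num.sqrt (f x))%:E <= rho%:E)%E ->
  measurable [set w | (\prod_(j < n) Num.sqrt (f (X j w)) <= \prod_(j < n) q (X j w))%R] /\
  (P [set w | (\prod_(j < n) Num.sqrt (f (X j w)) <= \prod_(j < n) q (X j w))%R]
    <= (rho ^+ n)%:E)%E.
Proof.
move=> Xi Xf mf f0 mq q0 qf.
pose Y j : T -> R := X j.
have mY j : measurable_fun setT (Y j) by [].
have YE j (A : set R) : measurable A ->
    (P (Y j @^-1` A) = \int[lebesgue_measure]_(x in A) (f x)%:E)%E by exact: Xf.
have Yid j (A : set R) : measurable A -> P (Y j @^-1` A) = P (Y 0 @^-1` A).
  by move=> mA; rewrite !YE.
have Yi k (B : 'I_k -> set R) : (forall j, measurable (B j)) ->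
     P (\bigcap_(j : 'I_k) (Y j @^-1` B j)) = (\prod_(j < k) P (Y j @^-1` B j))%E.
  exact: mutually_independent_ord.
have msf : measurable_fun setT (fun x => Num.sqrt (f x)).
  exact: (measurableT_comp (continuous_measurable_fun (@sqrt_continuous R))).
have mprod (h : R -> R) : measurable_fun setT h ->
    measurable_fun setT (fun w => \prod_(j < n) h (Y j w)).
  move=> mh; apply: measurable_prod => j _; exact: (measurableT_comp mh).
(* Division by zero yields 0, so [r * f = q * sqrt f] holds at the zeros of [f] as well. *)
pose r x := q x / Num.sqrt (f x).
have mr : measurable_fun setT r.
  under [X in measurable_fun _ X]eq_fun do rewrite /r -powR_inv1 ?sqrtr_ge0//.
  by apply: measurable_funM => //; apply: (measurableT_comp (measurable_powR _)).
have r0 x : 0 <= r x by rewrite divr_ge0.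
have rrho : (\int[P]_w (r (Y 0 w))%:E <= rho%:E)%E.
  apply: le_trans (integral_density_le (mY 0%N) mf f0 (YE 0%N) mr r0) _.
  apply: le_trans qf; rewrite le_eqVlt; apply/orP; left; apply/eqP.
  apply: eq_integral => x _; congr (_%:E).
  have [->|fx] := eqVneq (f x) 0; first by rewrite sqrtr0 !mulr0.
  rewrite /r -[X in _ * X](sqr_sqrtr (f0 x)) expr2 mulrA divfK//.
  by rewrite sqrtr_eq0 -ltNge lt_def fx f0.
(* Almost surely no observation is a zero of [f]; off these null events the product of the [sqrt f]
   is positive and can be divided out. *)
pose N j := Y j @^-1` (f @^-1` [set 0]).
have mf0 : measurable (f @^-1` [set 0]).
  by rewrite -[X in measurable X]setTI; exact: mf.
have mNj j : measurable (N j) by rewrite -[X in measurable X]setTI; exact: mY.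
have N0 j : P (N j) = 0.
  rewrite YE//; apply: integral0_eq => x /= ->//.
set S := [set w | _].
have mS : measurable S.
  rewrite -[S]setTI; apply: measurable_fun_le => //; first exact: (mprod _ msf).
  exact: (mprod _ mq).
split => //.
pose A := [set w | 1 <= \prod_(j < n) r (Y j w)].
have mA : measurable A.
  by rewrite -[A]setTI; apply: measurable_fun_le => //; exact: (mprod _ mr).
have SA : S `<=` A `|` \bigcup_j N j.
  move=> w Sw; case: (pselect (exists j : 'I_n, f (Y j w) = 0)) => [[j fj]|nf].
    by right; exists j.
  left; rewrite /A/= big_split/= prodfV ler_pdivlMr ?mul1r//.
  apply: prodr_gt0 => j _; rewrite sqrtr_gt0 lt_def f0 andbT.
  by apply/eqP => fj; apply: nf; exists j.
have mN : measurable (\bigcup_j N j).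
  exact: bigcupT_measurable.
apply: le_trans (le_measure P _ _ SA) _; rewrite ?inE//; first exact: measurableU.
apply: le_trans (measureU2 _ _ _) _ => //.
rewrite [X in (_ + X)%E](_ : _ = 0)%E ?adde0.
  apply: le_trans (expectation_prod_le n mY Yi Yid mr r0 rrho).
  (* Markov's inequality by hand: the indicator of [A] is at most the product of the ratios. *)
  apply: (@le_trans _ _ (\int[P]_w (\1_A w)%:E)%E).
    by rewrite integral_indic// setIT.
  apply: ge0_le_integral => //.
  - by apply/measurable_EFinP.
  - by apply/measurable_EFinP; exact: (mprod _ mr).
  - move=> w _; rewrite lee_fin indicE.
    have [|_] := boolP (w \in A); first by rewrite inE.
    by rewrite prodr_ge0.
apply: measure_negligible => //; apply: negligible_bigcup => j.
by exists (N j); split => //; exact: N0.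
Qed.

(** * Strict bound on the Hellinger affinity *)

Lemma Rintegral_gt0_itv01 (R : realType) (f : R -> R) (x : R) :
  continuous f -> (forall y, 0 <= f y) -> 0 <= x <= 1 -> 0 < f x ->
  0 < \int[@lebesgue_measure R]_(y in `[0, 1]) f y.
Proof.
move=> cf f0 /andP[x0 x1] fx.
have [e /= e0 fe] : exists2 e : R, 0 < e & forall y, `|x - y| < e -> f x / 2 < f y.
  have /cvgrPdist_lt/(_ (f x / 2)) := cf x.
  have fx2 : 0 < f x / 2 by rewrite divr_gt0.
  move=> /(_ fx2)[e /= e0 H]; exists e => // y /H/=.
  by rewrite ltr_norml => /andP[_]; lra.
(* The radius is halved so that the closed segment stays in the open neighbourhood; clipping to
   [0, 1] leaves positive length even if [x] is an endpoint. *)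
pose p := Num.max 0 (x - e / 2); pose q := Num.min 1 (x + e / 2).
have pq : p < q by rewrite /p /q gt_max !lt_min; apply/andP; split; apply/andP; split; lra.
have p0 : 0 <= p by rewrite le_max lexx.
have q1 : q <= 1 by rewrite ge_min lexx.
have px : x - e / 2 <= p by rewrite le_max lexx orbT.
have qx : q <= x + e / 2 by rewrite ge_min lexx orbT.
have fi := @continuous_integrable_itv R f 0 1 cf.
rewrite fine_gt0//; apply/andP; split; last first.
  by rewrite ltey_eq (integrable_fin_num _ fi).
apply: (@lt_le_trans _ _ (\int[@lebesgue_measure R]_(y in `[p, q]) (cst (f x / 2)%:E y))%E).
  rewrite integral_cst//= lebesgue_measure_itv/= lte_fin pq -EFinD -EFinM lte_fin.
  by rewrite mulr_gt0 ?subr_gt0// divr_gt0.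
apply: (@le_trans _ _ (\int[@lebesgue_measure R]_(y in `[p, q]) (f y)%:E)%E).
  apply: ge0_le_integral => //.
  - by move=> y _; rewrite lee_fin divr_ge0// ltW.
  - by apply/measurable_EFinP; apply: measurable_funTS; exact: continuous_measurable_fun.
  - move=> y; rewrite /= in_itv/= => /andP[py yq]; rewrite lee_fin ltW// fe//.
    by rewrite ltr_norml; apply/andP; split; lra.
apply: ge0_subset_integral => //.
- by apply/measurable_EFinP; apply: measurable_funTS; exact: continuous_measurable_fun.
- by move=> y _; rewrite lee_fin.
- by move=> y; rewrite /= !in_itv/= => /andP[py yq]; apply/andP; split; lra.
Qed.

(** Equality case of Cauchy-Schwarz: the integral of [(a - b) ^+ 2] equals 2 minus twice that of
    [a * b], and it is positive by continuity at [x]. *)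
Lemma Rintegral_mul_lt1 (R : realType) (a b : R -> R) (x : R) :
  continuous a -> continuous b ->
  \int[@lebesgue_measure R]_(y in `[0, 1]) a y ^+ 2 = 1 ->
  \int[@lebesgue_measure R]_(y in `[0, 1]) b y ^+ 2 = 1 ->
  0 <= x <= 1 -> a x != b x ->
  \int[@lebesgue_measure R]_(y in `[0, 1]) (a y * b y) < 1.
Proof.
move=> ca cb a1 b1 x01 abx.
have cM (f h : R -> R) : continuous f -> continuous h -> continuous (fun y => f y * h y).
  by move=> cf ch y; apply: cvgM; [exact: cf|exact: ch].
have cX (f : R -> R) : continuous f -> continuous (fun y => f y ^+ 2).
  by move=> cf; apply: cM.
have cD : continuous (fun y => (a y - b y) ^+ 2).
  by apply: cX => y; apply: cvgB; [exact: ca|exact: cb].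
have D0 y : 0 <= (a y - b y) ^+ 2 by exact: sqr_ge0.
have Dx : 0 < (a x - b x) ^+ 2 by rewrite lt_def D0 andbT sqrf_eq0 subr_eq0.
have := Rintegral_gt0_itv01 cD D0 x01 Dx.
have i f : continuous f -> _ := @continuous_integrable_itv R f 0 1.
have -> : \int[@lebesgue_measure R]_(y in `[0, 1]) (a y - b y) ^+ 2 =
   \int[@lebesgue_measure R]_(y in `[0, 1]) ((a y ^+ 2 + b y ^+ 2) - 2 * (a y * b y)).
  by apply: eq_Rintegral => y _; ring.
rewrite RintegralB//; last 2 first.
- by apply: i => y; apply: cvgD; apply: cX.
- by apply: i => y; apply: cvgM; [exact: cvg_cst|exact: cM].
rewrite RintegralD//; [|by apply: i; exact: cX|by apply: i; exact: cX].
rewrite RintegralZl//; last by apply: i; exact: cM.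
by rewrite a1 b1; lra.
Qed.

(** * Local envelopes of square-root densities *)

(** Weights and peaks are moved one after the other. Each of the [g] weights costs at most [2 * e],
    as triangular densities are at most 2; the peaks cost [2 / dl * e] on average, as the weights of
    [v] sum to 1. *)
Lemma poly_density_dist (R : realType) (g : nat) (u v : 'rV[R]_(g + g)) (dl e x : R) :
  Theta R g u -> Theta R g v -> 0 < dl -> dl <= x <= 1 - dl ->
  (forall i, `|u 0 i - v 0 i| <= e) ->
  `|poly_density u x - poly_density v x| <= (2 * g%:R + 2 / dl) * e.
Proof.
move=> [wu0 wu1 pu] [wv0 wv1 pv] dl0 xdl uve.
rewrite /poly_density -sumrB; apply: le_trans (ler_norm_sum _ _ _) _.
have -> : (2 * g%:R + 2 / dl) * e = \sum_(i < g) (2 * e + weight v i * (2 / dl * e)).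
  by rewrite big_split/= sumr_const card_ord -mulr_suml wv1 -mulr_natr; ring.
apply: ler_sum => i _.
have -> : weight u i * tri_density (peak u i) x - weight v i * tri_density (peak v i) x =
  (weight u i - weight v i) * tri_density (peak u i) x +
  weight v i * (tri_density (peak u i) x - tri_density (peak v i) x) by ring.
apply: le_trans (ler_normD _ _) _; rewrite !normrM; apply: lerD.
  rewrite [leRHS]mulrC; apply: ler_pM => //; first exact: (uve (lshift g i)).
  by rewrite ger0_norm ?tri_density_ge0 ?tri_density_le2.
rewrite (ger0_norm (wv0 i)) ler_wpM2l//.
apply: le_trans (tri_density_lip dl0 xdl (pu i) (pv i)) _.
by rewrite ler_wpM2l ?divr_ge0 ?(ltW dl0)//; exact: (uve (rshift g i)).
Qed.

Lemma measurable_poly_density (R : realType) (g : nat) (v : 'rV[R]_(g + g)) :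
  Theta R g v -> measurable_fun setT (poly_density v).
Proof.
move=> Tv.
have -> : poly_density v = fun x => poly_line v x * \1_`[0, 1] x.
  apply/funext => x; rewrite poly_densityE// indicE mem_setE in_itv/=.
  by case: ifP => _; rewrite ?mulr1 ?mulr0.
apply: measurable_funM; last exact: measurable_indic.
exact: continuous_measurable_fun (@continuous_poly_line _ _ v).
Qed.

(* The edges of [0, 1] are treated separately: at [x = 0] and [x = 1] the density
   is not continuous in the peak.  There [q] exceeds [sqrt 2], which bounds every
   [sqrt f], at the cost of a small integral. *)
Lemma local_envelope (R : realType) (g : nat) (u v : 'rV[R]_(g + g)) (x : R) :
  Theta R g u -> Theta R g v -> 0 <= x <= 1 -> poly_line u x != poly_line v x ->
  exists (q : R -> R) (rho e : R),
  [/\ measurable_fun setT q, forall y, 0 <= q y, 0 <= rho < 1, 0 < e &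
    (\int[lebesgue_measure]_y (q y * Num.sqrt (poly_density u y))%:E <= rho%:E)%E /\
    forall v' : 'rV[R]_(g + g), Theta R g v' -> (forall i, `|v' 0 i - v 0 i| <= e) ->
      forall y, Num.sqrt (poly_density v' y) <= q y].
Proof.
move=> Tu Tv x01 uvx.
pose a y := Num.sqrt (poly_line u y); pose b y := Num.sqrt (poly_line v y).
have cf (w : 'rV[R]_(g + g)) : continuous (fun y => Num.sqrt (poly_line w y)).
  move=> y; apply: (@continuous_comp _ _ _ (poly_line w) Num.sqrt).
    exact: continuous_poly_line.
  exact: sqrt_continuous.
have ca : continuous a := cf u; have cb : continuous b := cf v.
have pl0 (w : 'rV[R]_(g + g)) y : Theta R g w -> 0 <= y <= 1 -> 0 <= poly_line w y.
  by move=> Tw y01; have := poly_density_ge0 y Tw; rewrite poly_densityE// y01.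
have i2 (w : 'rV[R]_(g + g)) : Theta R g w ->
    \int[@lebesgue_measure R]_(y in `[0, 1]) (Num.sqrt (poly_line w y)) ^+ 2 = 1.
  move=> Tw; rewrite -[RHS](Rintegral_poly_line Tw); apply: eq_Rintegral => y.
  by rewrite inE/= in_itv/= => y01; rewrite sqr_sqrtr// pl0.
have abx : a x != b x by rewrite eqr_sqrt// pl0.
have := Rintegral_mul_lt1 ca cb (i2 _ Tu) (i2 _ Tv) x01 abx.
set r := (X in X < 1) => r1.
have r0 : 0 <= r by apply: Rintegral_ge0 => y _; rewrite mulr_ge0 ?sqrtr_ge0.
(* With these values the final bound [r + 2 * ka + 8 * dl] is [(1 + r) / 2], halfway between the
   affinity and 1. *)
pose dl := (1 - r) / 32; pose ka := (1 - r) / 8.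
have dl0 : 0 < dl by rewrite /dl; lra.
have dl1 : dl <= 1 / 32 by rewrite /dl; lra.
have ka0 : 0 < ka by rewrite /ka; lra.
pose M := `[dl, 1 - dl]%classic.
have mM : measurable M by exact: measurable_itv.
have m1M : measurable_fun setT (\1_M : R -> R) by exact: measurable_indic.
pose q y := b y + ka + 2 * (1 - \1_M y).
have q1 y : 0 <= 1 - \1_M y :> R by rewrite indicE; case: (_ \in _); rewrite ?subrr ?subr0.
have q0 y : 0 <= q y.
  by rewrite /q addr_ge0 ?mulr_ge0// addr_ge0 ?sqrtr_ge0// ltW.
have mq : measurable_fun setT q.
  apply: measurable_funD.
    by apply: measurable_funD => //; exact: continuous_measurable_fun.
  by apply: measurable_funM => //; apply: measurable_funB => //; exact: m1M.
have L0 : 0 < 2 * g%:R + 2 / dl.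
  by rewrite ltr_wpDl ?mulr_ge0// divr_gt0.
(* The radius is [ka ^+ 2] over the constant of [poly_density_dist]: on [M] the density then rises
   by at most [ka ^+ 2], and [b y ^+ 2 + ka ^+ 2 <= (b y + ka) ^+ 2]. *)
exists q, (r + 2 * ka + 8 * dl), (ka ^+ 2 / (2 * g%:R + 2 / dl)); split.
- exact: mq.
- exact: q0.
- by rewrite /ka /dl; apply/andP; split; lra.
- by rewrite divr_gt0// exprn_gt0.
split; last first.
  move=> v' Tv' v'v y.
  have f2 : Num.sqrt (poly_density v' y) <= 2.
    rewrite -[leRHS]ger0_norm// -sqrtr_sqr ler_sqrt//.
    by apply: le_trans (poly_density_le2 _ Tv') _; lra.
  have [My|nMy] := boolP (y \in M); last first.
    rewrite /q indicE (negbTE nMy) subr0 mulr1.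
    by apply: le_trans f2 _; rewrite lerDr addr_ge0 ?sqrtr_ge0// ltW.
  rewrite /q indicE My subrr mulr0 addr0.
  move: My; rewrite inE /M/= in_itv/= => yM.
  have := poly_density_dist Tv' Tv dl0 yM v'v.
  rewrite mulrC divfK ?gt_eqF// => /ler_normlP[_].
  have -> : poly_density v y = poly_line v y.
    by rewrite poly_densityE// ifT//; move: yM => /andP[? ?]; apply/andP; split; lra.
  move=> fy.
  have bE : b y ^+ 2 = poly_line v y.
    rewrite sqr_sqrtr// pl0//; move: yM => /andP[? ?]; apply/andP; split; lra.
  have b0 : 0 <= b y by exact: sqrtr_ge0.
  have -> : b y + ka = Num.sqrt ((b y + ka) ^+ 2) by rewrite sqrtr_sqr ger0_norm// addr_ge0// ltW.
  rewrite ler_sqrt ?sqr_ge0//; rewrite -bE in fy.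
  have : 0 <= b y * ka by rewrite mulr_ge0// ltW.
  by rewrite sqrrD; lra.
(* This bounds [q * a] on [0, 1] by replacing the factor [a] of the two correction terms by 2. The
   edges have total length [2 * dl], whence the [8 * dl]. *)
pose h y := a y * b y + 2 * ka + 4 * (1 - \1_M y).
have cab : continuous (fun y => a y * b y + 2 * ka).
  move=> y; apply: cvgD; last exact: cvg_cst.
  by apply: cvgM; [exact: ca|exact: cb].
have iab := @continuous_integrable_itv R _ 0 1 cab.
have i1 : (@lebesgue_measure R).-integrable `[0, 1] (EFin \o (fun=> 1 : R)).
  by apply: continuous_integrable_itv => y; exact: cvg_cst.
have iM : (@lebesgue_measure R).-integrable `[0, 1] (EFin \o (\1_M : R -> R)).
  by apply: integrableS (integrable_indic_itv dl (1 - dl) true false).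
have iB : (@lebesgue_measure R).-integrable `[0, 1] (EFin \o (fun y => 1 - \1_M y : R)).
  by apply: (integrableB _ i1 iM).
have iZ : (@lebesgue_measure R).-integrable `[0, 1] (EFin \o (fun y => 4 * (1 - \1_M y) : R)).
  by apply: (integrableZl _ 4 iB).
have ih : (@lebesgue_measure R).-integrable `[0, 1] (EFin \o h).
  by apply: (integrableD _ iab iZ).
have intM : \int[@lebesgue_measure R]_(y in `[0, 1]) (4 * (1 - \1_M y)) = 8 * dl.
  rewrite RintegralZl// RintegralB// Rintegral_cst//.
  rewrite [X in _ * (_ - X)]/Rintegral integral_indic// setIidl; last first.
    by move=> y; rewrite /M/= !in_itv/= => /andP[? ?]; apply/andP; split; lra.
  rewrite /M/=. rewrite !lebesgue_measure_itv/= !lte_fin ltr01 ifT /=; last by lra.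
  by lra.
have hE : \int[@lebesgue_measure R]_(y in `[0, 1]) h y = r + 2 * ka + 8 * dl.
  rewrite RintegralD// RintegralD//; last 2 first.
  - by apply: continuous_integrable_itv => y; apply: cvgM; [exact: ca|exact: cb].
  - by apply: continuous_integrable_itv => y; exact: cvg_cst.
  rewrite intM Rintegral_cst//= lebesgue_measure_itv/= lte_fin ltr01/=.
  by rewrite -/r; lra.
rewrite -hE fineK; last exact: integrable_fin_num.
rewrite [leRHS]integral_mkcond/=.
apply: ge0_le_integral => //.
- by move=> y _; rewrite lee_fin mulr_ge0 ?sqrtr_ge0.
- apply/measurable_EFinP; apply: measurable_funM.
    exact: mq.
  apply: (measurableT_comp (continuous_measurable_fun (@sqrt_continuous R))).
  exact: measurable_poly_density.
- by apply: (measurable_restrictT (EFin \o h) _).1 => //; exact: (measurable_int _ ih).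
- move=> y _; rewrite patchE mem_setE in_itv/=.
  have := poly_densityE y Tu; case: ifPn => y01 ->; last by rewrite sqrtr0 mulr0.
  rewrite lee_fin /h /q -/(a y).
  have a2 : a y <= 2.
    rewrite -[leRHS]ger0_norm// -sqrtr_sqr ler_sqrt//.
    have := poly_density_le2 y Tu; rewrite poly_densityE// y01; lra.
  have a0 : 0 <= a y by exact: sqrtr_ge0.
  have := q1 y; set t := 1 - _ => t0.
  (* This product is exactly [h y - q y * a y]. *)
  have : 0 <= (2 - a y) * (ka + 2 * t).
    by apply: mulr_ge0; [rewrite subr_ge0|apply: addr_ge0; [exact: ltW|apply: mulr_ge0]].
  by lra.
Qed.

(** * Likelihood maximizers *)

Lemma poly_line_eq_loglik (R : realType) (g n : nat) (u v : 'rV[R]_(g + g))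
    (x : n.-tuple R) : Theta R g u -> Theta R g v ->
  (forall y, 0 <= y <= 1 -> poly_line u y = poly_line v y) ->
  loglik u x = loglik v x.
Proof.
move=> Tu Tv uv; apply: eq_bigr => j _; congr (lne _%:E).
by rewrite !poly_densityE//; case: ifP => // /uv.
Qed.

(** If the two curves agreed on [0, 1], the log-likelihoods would agree on every sample, so would
    their means, and [v] would be a maximizer too. *)
Lemma Theta_mean_poly_line_neq d (T : measurableType d) (R : realType)
    (P : probability T R) (X : nat -> {RV P >-> R}) (g n : nat)
    (u v : 'rV[R]_(g + g)) :
  Theta_mean X g n u -> Theta R g v -> ~ Theta_mean X g n v ->
  exists x, 0 <= x <= 1 /\ poly_line u x != poly_line v x.
Proof.
move=> [Tu Mu] Tv nMv; apply: contrapT => /forallNP uv; apply: nMv.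
split => //; rewrite -Mu; apply: eq_integral => w _.
apply: poly_line_eq_loglik => // y y01.
by have [//|uvy] := eqVneq (poly_line v y) (poly_line u y); case: (uv y); rewrite eq_sym.
Qed.

(** A vanishing factor is covered as well, because [lne] sends 0 to [-oo] and [expeR] sends [-oo]
    back to 0. *)
Lemma expeR_loglik (R : realType) (g n : nat) (v : 'rV[R]_(g + g)) (x : n.-tuple R) :
  Theta R g v ->
  expeR (loglik v x) = (\prod_(j < n) poly_density v (tnth x j))%:E.
Proof.
move=> Tv; rewrite /loglik (big_morph (@expeR R) (@expeRD R) (@expeR0 R)) -prodEFin.
apply: eq_bigr => j _; rewrite lneK// in_itv/= lee_fin leey andbT.
exact: poly_density_ge0.
Qed.

Lemma Theta_mle_prod_le (R : realType) (g n : nat) (u v : 'rV[R]_(g + g))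
    (x : n.-tuple R) : Theta R g u -> Theta_mle g x v ->
  \prod_(j < n) poly_density u (tnth x j) <= \prod_(j < n) poly_density v (tnth x j).
Proof.
move=> Tu [Tv Mv]; rewrite -lee_fin -!expeR_loglik// lee_expeR Mv.
by apply: ereal_sup_ubound; exists u.
Qed.

(** * Euclidean distance to a set, Borel sets and geometric sums *)

Lemma norm2_ge0 (R : realType) (k : nat) (v : 'rV[R]_k) : 0 <= norm2 v.
Proof. exact: sqrtr_ge0. Qed.

Lemma continuous_norm2B (R : realType) (k : nat) (t : 'rV[R]_k) :
  continuous (fun v : 'rV[R]_k => norm2 (v - t)).
Proof.
move=> v; apply: (@continuous_comp _ _ _
  (fun v : 'rV[R]_k => \sum_(i < k) (v - t) 0 i ^+ 2) Num.sqrt); last first.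
  exact: sqrt_continuous.
apply: (@continuous_big _ _ +%R 0 xpredT _ _ _
  (fun i (v : 'rV[R]_k) => (v - t) 0 i ^+ 2)) => [|i _ {}v].
  exact: add_continuous.
have c : {for v, continuous (fun v : 'rV[R]_k => (v - t) 0 i)}.
  rewrite (_ : (fun _ => _) = (fun v : 'rV[R]_k => v 0 i - t 0 i)); last first.
    by apply/funext => w; rewrite !mxE.
  have c0 := @coord_continuous R 1 k 0 i v.
  exact: (cvgB c0 (cvg_cst _)).
exact: (cvgM c c).
Qed.

(** Nonemptiness matters: the real infimum of the empty set is 0 by default. *)
Lemma inf_norm2P (R : realType) (k : nat) (S : set 'rV[R]_k) (e : R) (v : 'rV[R]_k) :
  S !=set0 ->
  e <= inf [set norm2 (v - t) | t in S] <-> forall t, S t -> e <= norm2 (v - t).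
Proof.
move=> [t0 St0]; split=> [einf t St|H].
  apply: (le_trans einf); apply: ge_inf; last by exists t.
  by exists 0 => _ [s _ <-]; exact: norm2_ge0.
apply: lb_le_inf; first by exists (norm2 (v - t0)), t0.
by move=> _ [t St <-]; exact: H.
Qed.

(** An intersection of closed conditions, one for each point of [S]. It serves both compactness and
    Borel measurability of the bad set of parameters. *)
Lemma closed_inf_norm2 (R : realType) (k : nat) (S : set 'rV[R]_k) (e : R) :
  S !=set0 -> closed [set v | e <= inf [set norm2 (v - t) | t in S]].
Proof.
move=> S0; rewrite (_ : [set _ | _] = \bigcap_(t in S) [set v | e <= norm2 (v - t)]).
  apply: closed_bigI => t _.
  have /continuous_closedP := @continuous_norm2B R k t.
  by move=> /(_ _ (@closed_ge R e)).
by apply/seteqP; split=> v /=; rewrite inf_norm2P.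
Qed.

Lemma borel_closed (T : topologicalType) (C : set T) :
  closed C -> <<s [set U : set T | open U] >> C.
Proof.
move=> cC; rewrite -[C]setCK -setTD; apply: (@sigma_algebraCD _ _ _ (~` C)).
by apply: sub_gen_smallest; exact: closed_openC.
Qed.

Lemma measurable_sample d (T : measurableType d) (R : realType)
    (P : probability T R) (X : nat -> {RV P >-> R}) (n : nat) :
  measurable_fun setT (sample X n).
Proof.
apply/measurable_fun_tnthP => i.
rewrite (_ : _ \o _ = X i :> (T -> R)); first by [].
by apply/funext => w; rewrite /= tnth_mktuple.
Qed.

Lemma cvg_sum_geometric (R : realType) (I : choiceType) (D : {fset I}) (rho : I -> R) :
  (forall i, i \in D -> 0 <= rho i < 1) ->
  ((\sum_(i <- D) (rho i) ^+ n)%:E @[n --> \oo] --> 0)%E.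
Proof.
move=> rho01.
(* Convergence is required at every index of the type, so terms outside [D] are set to 0. *)
have c i : (if i \in D then rho i ^+ n else 0) @[n --> \oo] --> (0 : R).
  have [/rho01/andP[r0 r1]|_] := boolP (i \in D); last exact: cvg_cst.
  by apply: cvg_expr; rewrite ger0_norm.
have := @cvg_big R I +%R 0 xpredT (@add_continuous _) nat \oo D
  (fun i n => if i \in D then rho i ^+ n else 0) (fun=> 0) _ (fun i _ => c i).
rewrite big1// => H; apply: cvg_EFin; first exact: nearW.
have {}H := H _; rewrite (_ : _ \o _ =
  fun n => \sum_(i <- D) (if i \in D then rho i ^+ n else 0)).
  exact: H.
by apply/funext => n /=; apply: eq_big_seq => i ->.
Qed.

Theorem theorem1 (R : realType) (d : measure_display) (T : measurableType d)
  (P : probability T R) (g : nat) (g_gt0 : (0 < g)%N)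
  (X : nat -> {RV P >-> R}) (theta0 : 'rV[R]_(g + g))
  (X_indep : mutually_independent X)
  (X_density : forall j, has_density (X j) (poly_density theta0))
  (m : nat) (m_gt0 : (0 < m)%N)
  (theta0_mean : theta0 \in Theta_mean X g m)
  (thetahat : forall n : nat, n.-tuple R -> 'rV[R]_(g + g))
  (thetahat_meas : forall n, borel_measurable (thetahat n))
  (thetahat_mle : forall n w,
     thetahat n (sample X n w) \in Theta_mle g (sample X n w))
  (eps : R) (eps_gt0 : 0 < eps)
  (K : set 'rV[R]_(g + g)) (K_compact : compact K) (K_sub : K `<=` Theta R g) :
  P [set w |
       eps <= inf [set norm2 (thetahat n (sample X n w) - theta)
                    | theta in Theta_mean X g m] /\
       K (thetahat n (sample X n w))] @[n --> \oo] --> 0%E.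
Proof.
have S0 : Theta_mean X g m theta0 by move: theta0_mean; rewrite inE.
have Tu : Theta R g theta0 by case: S0.
set S := Theta_mean X g m in S0 *.
have S_ne : S !=set0 by exists theta0.
(* The event says that the estimator lies in [C], a compact set containing no maximizer of the mean
   log-likelihood. *)
pose C := K `&` [set v | eps <= inf [set norm2 (v - t) | t in S]].
have Cc : compact C.
  exact: (compact_closedI K_compact (@closed_inf_norm2 R (g + g) S eps S_ne)).
have Ccl : closed C by apply: compact_closed => //; exact: norm_hausdorff.
have CS v : C v -> ~ S v.
  move=> [_ /=]; rewrite inf_norm2P// => H Sv; have := H v Sv.
  by rewrite subrr /norm2 big1 ?sqrtr0 ?leNgt ?eps_gt0// => i _; rewrite mxE expr0n.
have CT v : C v -> Theta R g v by move=> [/K_sub].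
(* The triple [p] packs the envelope [q], the bound [rho] and the radius [e]. It must exist for
   every [v] before a choice function can be taken, so arbitrary values are given outside [C]. *)
have env v : exists p : (R -> R) * R * R, C v ->
  [/\ measurable_fun setT p.1.1, forall y, 0 <= p.1.1 y, 0 <= p.1.2 < 1, 0 < p.2 &
    (\int[lebesgue_measure]_y (p.1.1 y * Num.sqrt (poly_density theta0 y))%:E <= (p.1.2)%:E)%E /\
    forall v' : 'rV[R]_(g + g), Theta R g v' -> (forall i, `|v' 0 i - v 0 i| <= p.2) ->
      forall y, Num.sqrt (poly_density v' y) <= p.1.1 y].
  have [Cv|nCv] := pselect (C v); last by exists ((fun=> 0), 0, 0).
  have [x [x01 neq]] := Theta_mean_poly_line_neq S0 (CT v Cv) (CS v Cv).
  by have [q [rho [e H]]] := local_envelope Tu (CT v Cv) x01 neq; exists (q, rho, e).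
have {env} [p env] := choice env.
(* Balls of matrices are entrywise, which matches the closeness condition of the envelopes. *)
move: Cc; rewrite compact_cover => /(_ _ C (fun v => (ball v (p v).2)°)) [|v Cv|].
- by move=> v Cv; exact: open_interior.
- exists v => //; have [_ _ _ e0 _] := env v Cv.
  by apply: nbhsx_ballx.
move=> D DC CD.
pose A n v := [set w | \prod_(j < n) Num.sqrt (poly_density theta0 (X j w)) <=
                       \prod_(j < n) (p v).1.1 (X j w)].
have tail n v : C v -> measurable (A n v) /\ (P (A n v) <= ((p v).1.2 ^+ n)%:E)%E.
  move=> Cv; have [mq q0 _ _ [qi _]] := env v Cv.
  apply: likelihood_ratio_tail => //; first exact: measurable_poly_density.
  by move=> y; exact: poly_density_ge0.
pose E n := [set w | C (thetahat n (sample X n w))].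
have -> : (fun n => P [set w |
      eps <= inf [set norm2 (thetahat n (sample X n w) - t) | t in S] /\
      K (thetahat n (sample X n w))]) = fun n => P (E n).
  by apply/funext => n; congr (P _); apply/seteqP; split=> w [].
have mE n : measurable (E n).
  have mC : measurable (thetahat n @^-1` C) by apply: thetahat_meas; exact: borel_closed.
  by have := @measurable_sample _ _ _ P X n measurableT _ mC; rewrite setTI.
have EA n : E n `<=` \bigcup_(v in [set` D]) A n v.
  move=> w Ew; have [v /= vD] := CD _ Ew.
  move=> /interior_subset bv; exists v => //.
  have [_ q0 _ _ [_ /(_ _ (CT _ Ew)) le_q]] := env v (set_mem (DC v vD)).
  (* The likelihood of the estimator mediates. It is at least that of [theta0] by maximality,
     compared after squaring away the roots, and its root is at most the product of the envelopes,
     factor by factor. *)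
  apply: (@le_trans _ _
    (\prod_(j < n) Num.sqrt (poly_density (thetahat n (sample X n w)) (X j w)))).
    rewrite -(@ler_pXn2r _ 2)// ?nnegrE ?prodr_ge0//.
    have sqE v' : Theta R g v' ->
        (\prod_(j < n) Num.sqrt (poly_density v' (X j w))) ^+ 2 =
        \prod_(j < n) poly_density v' (tnth (sample X n w) j).
      move=> Tv'; rewrite -prodrXl; apply: eq_bigr => j _.
      by rewrite sqr_sqrtr ?poly_density_ge0// tnth_mktuple.
    rewrite (sqE _ Tu) (sqE _ (CT _ Ew)).
    exact: Theta_mle_prod_le Tu (set_mem (thetahat_mle n w)).
  apply: ler_prod => j _; rewrite sqrtr_ge0/=; apply: le_q => i.
  by rewrite distrC ltW//; have [_ /(_ 0 i)] := bv.
(* The union bound over the finite subcover leaves a finite sum of geometric sequences. *)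
apply: (@squeeze_cvge _ _ _ _ (fun=> 0%E) _ (fun n => (\sum_(v <- D) ((p v).1.2) ^+ n)%:E)).
- apply: nearW => n; rewrite measure_ge0/=.
  have DC' v : v \in D -> C v by move=> vD; exact: (set_mem (DC v vD)).
  apply: le_trans (@content_sub_fsum _ _ _ P _ [set` D] (E n) (A n) _ _ _ _) _ => //.
    by move=> v /= /DC' Cv; have [] := tail n v Cv.
  rewrite fsbig_finite//= set_fsetK -sumEFin big_seq [leRHS]big_seq.
  by apply: lee_sum => v /DC' Cv; have [] := tail n v Cv.
- exact: cvg_cst.
- apply: cvg_sum_geometric => v vD.
  by have [] := env v (set_mem (DC v vD)).
Qed.
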